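(* Every simple compact Hausdorff topological semiring is finite.
   Context: A semiring is an algebra $(R,+,\cdot,0)$ such that $(R,+,0)$ is a commutative monoid, $(R,\cdot)$ is a semigroup (no multiplicative identity is required), multiplication distributes over addition on both sides, and $0\cdot x = x\cdot 0 = 0$ for all $x\in R$. A homomorphism of semirings is a map that is a homomorphism of the additive monoids and of the multiplicative semigroups. A topological semiring is a semiring with a topology in which addition and multiplication are continuous. A Hausdorff topological semiring $R$ is called simple if every non-constant continuous semiring homomorphism from $R$ into any Hausdorff topological semiring is injective. *)

(* Defs.v *)
From HB Require Import structures.
From mathcomp Require Import all_boot all_order.
From mathcomp Require Import all_classical topology.
Set Implicit Arguments. Unset Strict Implicit. Unset Printing Implicit Defensive.
Local Open Scope classical_set_scope.

Definition is_semiring (T : Type) (add mul : T -> T -> T) (z : T) : Prop :=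
  associative add /\ commutative add /\ left_id z add /\
  associative mul /\
  (forall x y w, mul x (add y w) = add (mul x y) (mul x w)) /\
  (forall x y w, mul (add x y) w = add (mul x w) (mul y w)) /\
  (forall x, mul z x = z /\ mul x z = z).

Definition is_top_semiring (T : topologicalType) (add mul : T -> T -> T)
    (z : T) : Prop :=
  [/\ is_semiring add mul z,
      continuous (fun p : T * T => add p.1 p.2) &
      continuous (fun p : T * T => mul p.1 p.2)].

Definition is_semiring_hom (T S : Type) (addT mulT : T -> T -> T) (zT : T)
    (addS mulS : S -> S -> S) (zS : S) (f : T -> S) : Prop :=
  [/\ f zT = zS,
      (forall x y, f (addT x y) = addS (f x) (f y)) &
      (forall x y, f (mulT x y) = mulS (f x) (f y))].

Definition simple_top_semiring (T : topologicalType) (add mul : T -> T -> T)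
    (z : T) : Prop :=
  is_top_semiring add mul z /\ hausdorff_space T /\
  forall (S : topologicalType) (addS mulS : S -> S -> S) (zS : S),
    is_top_semiring addS mulS zS -> hausdorff_space S ->
    forall f : T -> S, continuous f ->
      is_semiring_hom add mul z addS mulS zS f ->
      (exists x y, f x <> f y) -> injective f.

(* Main.v *)
Require Import Defs.
From HB Require Import structures.
From mathcomp Require Import all_boot all_order all_algebra.
From mathcomp Require Import cyclic separable cyclotomic complex ring lra.
From mathcomp Require Import all_classical reals topology normedtype Rstruct.
Set Implicit Arguments. Unset Strict Implicit. Unset Printing Implicit Defensive.
Import Order.TTheory GRing.Theory Num.Theory.
Import numFieldNormedType.Exports.
Local Open Scope classical_set_scope.

(** A simple compact semiring [T] has no closed congruence besides equality and
the total relation.  If [A] is clopen, then by compactness its syntactic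
congruence has open classes, so an infinite [T] is connected.

Let [T] be infinite, and let [e] be the idempotent of the minimal ideal of the
compact monoid [(T, +)].  Since [x ~ y <-> e + x = e + y] is a closed
congruence, either [e = 0] and [T] is a ring, or [e] absorbs addition.

If [e] is absorbing, either the multiplication is zero, and then Rees
congruences make every [x <> e] invertible, so [e] is isolated; or [T] acts
faithfully on itself.  In the second case [x + t = y + t] is a congruence for
[t = e a e], so that [e a e] is [0] or [e], and [a |-> e a e] disconnects [T].

If [T] is a ring, its additive group has a nontrivial continuous character [X].
As small neighbourhoods of [1] in the circle contain no subgroup,
[{v | X (r v) = 1 for all r}] is clopen, so [X] is trivial on products and is a
homomorphism to the circle with constant multiplication.  Hence [X] is
injective and [T] has zero multiplication; by connectedness [X] takes a value
of real part [0], which contradicts the simplicity applied to [x |-> x + x].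

The character is a limit of characters of finite groups [(Z/N)^k] mapped almost
homomorphically to [T]: by recurrence, any finitely many elements of a compact
group have a common multiple [N] moving them close to [0].  If [h] is continuous
then [h (x + u)] is close to [h x] for a positive proportion of [u], bounded
below independently of the finite group, and Parseval's identity for the
autocorrelation yields a uniformly large Fourier coefficient of [h].  The
corresponding characters are equicontinuous.  Choosing [h y = f (y + g) - f y]
makes the limit nontrivial at [g]. *)

(** * Characters of finite abelian groups *)

Local Open Scope ring_scope.

Section FiniteCharacter.
Variables (C : numClosedFieldType) (H : finZmodType).

Record character (X : H -> C) : Prop := Character {
  characterD : forall x y, X (x + y) = X x * X y;
  character_norm : forall x, `|X x| = 1 }.

Lemma character0 X : character X -> X 0 = 1.
Proof.
move=> cX; have /eqP := characterD cX 0 0.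
rewrite addr0 -{1}[X 0]mulr1 (can_eq (mulKf _)) => [/eqP<-//|].
by rewrite -normr_eq0 character_norm // oner_eq0.
Qed.

Lemma characterN X x : character X -> X (- x) = (X x)^*.
Proof.
move=> cX; have nX : X x != 0 by rewrite -normr_eq0 character_norm // oner_eq0.
apply: (mulfI nX); rewrite -characterD // subrr character0 // -normCK.
by rewrite character_norm // expr1n.
Qed.

(** Translating [F] by [u] multiplies its Fourier coefficient at [X] by [X u]. *)
Lemma character_shift X (F : H -> C) u : character X ->
  \sum_x (F (x + u) - F x) * (X x)^* = (X u - 1) * \sum_x F x * (X x)^*.
Proof.
move=> cX; rewrite mulrBl mul1r.
under eq_bigr do rewrite mulrBl.
rewrite sumrB; congr (_ - _).
rewrite (reindex_inj (addIr (- u))) /= mulr_sumr; apply: eq_bigr => x _.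
by rewrite subrK -!characterN // opprB addrC characterD //; ring.
Qed.

(** By [character_shift], a large coefficient of [F] forces [X u] to be near 1 whenever [u] almost
    preserves [F]. This is the source of equicontinuity. *)
Lemma character_displacement X (F : H -> C) u (c e : C) : character X ->
    0 <= c -> c * #|H|%:R <= `|\sum_x F x * (X x)^*| ->
    (forall x, `|F (x + u) - F x| <= e) -> c * `|X u - 1| <= e.
Proof.
move=> cX c0 cF Fe.
have H0 : 0 < #|H|%:R :> C by rewrite ltr0n; apply/card_gt0P; exists 0.
rewrite -(ler_pM2r H0) mulrAC; apply: le_trans (ler_wpM2r (normr_ge0 _) cF) _.
rewrite mulrC -normrM -character_shift //; apply: le_trans (ler_norm_sum _ _ _) _.
rewrite mulr_natr -sumr_const; apply: ler_sum => x _.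
by rewrite normrM norm_conjC character_norm // mulr1.
Qed.

(** * Large Fourier coefficients of almost periodic functions *)

Section Fourier.
Variables (I : finType) (X : I -> H -> C).
Hypothesis cX : forall i, character (X i).
Hypothesis sumX : forall x, \sum_i X i x = (x == 0)%:R * #|H|%:R.

Definition fourier (F : H -> C) i := \sum_x F x * (X i x)^*.

(** After expansion of the square, the orthogonality [sumX] leaves only the diagonal terms. *)
Lemma parseval F :
  \sum_i `|fourier F i| ^+ 2 = #|H|%:R * \sum_x `|F x| ^+ 2.
Proof.
transitivity (\sum_i \sum_x \sum_y F x * (F y)^* * X i (y - x)).
  apply: eq_bigr => i _; rewrite normCK rmorph_sum /= mulr_suml.
  apply: eq_bigr => x _; rewrite mulr_sumr; apply: eq_bigr => y _.
  rewrite rmorphM /= conjCK characterD // characterN //; ring.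
rewrite exchange_big mulr_sumr; apply: eq_bigr => x _.
rewrite exchange_big (bigD1 x) //= [X in _ + X]big1 => [|y nyx].
  by rewrite -mulr_sumr sumX subrr eqxx mul1r normCK addr0 mulrC.
by rewrite -mulr_sumr sumX subr_eq0 (negPf nyx) mul0r mulr0.
Qed.

Definition autocorrelation (F : H -> C) d := \sum_x F (x + d) * (F x)^*.

Lemma fourier_autocorrelation F i :
  fourier (autocorrelation F) i = `|fourier F i| ^+ 2.
Proof.
rewrite normCK rmorph_sum /= mulr_sumr /fourier.
under eq_bigr do rewrite mulr_suml.
rewrite exchange_big; apply: eq_bigr => x _ /=.
rewrite mulr_suml (reindex_inj (addIr (- x))) /=; apply: eq_bigr => d _.
rewrite (addrC x) subrK rmorphM /= conjCK -!(characterN _ (cX i)) opprB.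
rewrite addrC characterD //; ring.
Qed.

(** If all squared coefficients were below [c / 2 * #|H| ^ 2], Parseval for [F] would bound the sum
    of their squares by [c / 2 * #|H| ^ 4], whereas Parseval for the autocorrelation makes it at
    least [c * #|H| ^ 4]. *)
Lemma large_fourier F (c : C) : 0 < c ->
    \sum_x `|F x| ^+ 2 <= #|H|%:R ->
    c * #|H|%:R ^+ 3 <= \sum_d `|autocorrelation F d| ^+ 2 ->
  exists i, c / 2 * #|H|%:R ^+ 2 <= `|fourier F i| ^+ 2.
Proof.
move=> c0 F1 cF; have H0 : 0 < #|H|%:R :> C.
  by rewrite ltr0n; apply/card_gt0P; exists 0.
case: (boolP [exists i, c / 2 * #|H|%:R ^+ 2 <= `|fourier F i| ^+ 2]).
  by move=> /existsP.
rewrite negb_exists => /forallP small; exfalso.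
have {}small i : `|fourier F i| ^+ 2 < c / 2 * #|H|%:R ^+ 2.
  rewrite real_ltNge ?small //; apply: ger0_real; first exact: exprn_ge0.
  by rewrite mulr_ge0 ?divr_ge0 ?exprn_ge0 // ltW.
have := ler_wpM2l (ltW H0) cF; rewrite -parseval => ge4.
have le4 : \sum_i `|fourier (autocorrelation F) i| ^+ 2 <=
    c / 2 * #|H|%:R ^+ 2 * (#|H|%:R * #|H|%:R).
  apply: (@le_trans _ _ (\sum_i c / 2 * #|H|%:R ^+ 2 * `|fourier F i| ^+ 2)).
    apply: ler_sum => i _; rewrite fourier_autocorrelation normrX normr_id.
    by rewrite [X in X <= _]expr2 ler_wpM2r ?exprn_ge0 // ltW.
  rewrite -mulr_sumr parseval !ler_wpM2l // ?ltW //.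
  by rewrite mulr_gt0 ?divr_gt0 ?exprn_gt0.
have := le_trans ge4 le4; apply/negP; rewrite -real_ltNge.
- rewrite (_ : _ * _ * _ = c * #|H|%:R ^+ 4 / 2); last by field.
  rewrite (_ : _ * (_ * _) = c * #|H|%:R ^+ 4); last by ring.
  rewrite ltr_pdivrMr // mulr_natr mulr2n ltrDl mulr_gt0 ?exprn_gt0 //.
- by rewrite gtr0_real // !mulr_gt0 ?invr_gt0 // ?exprn_gt0.
- by rewrite gtr0_real // !mulr_gt0 ?invr_gt0 // ?exprn_gt0.
Qed.

Definition almost_periods (F : H -> C) (e : C) : {set H} :=
  [set u | [forall x, `|F (x + u) - F x| <= e]].

(** Since [F 0 = 1], [|F|] is at least 1/2 at each almost period of the first kind, so the energy of
    [F] is at least [a / 4 * #|H|]. A shift by an almost period of the second kind costs the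
    autocorrelation at most half of this bound; it is thus large on a proportion [b] of [H], and
    [large_fourier] applies. *)
Lemma almost_periods_fourier F (a b : C) : 0 < a -> a <= 1 -> 0 < b -> b <= 1 ->
    (forall x, `|F x| <= 1) -> F 0 = 1 ->
    a * #|H|%:R <= #|almost_periods F 2^-1|%:R ->
    b * #|H|%:R <= #|almost_periods F (a / 8)|%:R ->
  exists i, (a / 8) ^+ 2 * b / 2 * #|H|%:R <= `|fourier F i|.
Proof.
move=> a0 a1 b0 b1 F1 F00 aH bH.
have H0 : 0 < #|H|%:R :> C by rewrite ltr0n; apply/card_gt0P; exists 0.
have a80 : 0 < a / 8 by rewrite divr_gt0.
have F2 x : `|F x| ^+ 2 <= `|F x|.
  by rewrite expr2 -[leRHS]mulr1 ler_wpM2l.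
have sumF_le : \sum_x `|F x| ^+ 2 <= #|H|%:R.
  rewrite -sum1_card natr_sum; apply: ler_sum => x _.
  by rewrite (le_trans (F2 x)) // F1.
have sumF_ge : a / 4 * #|H|%:R <= \sum_x `|F x| ^+ 2.
  apply: (@le_trans _ _ (\sum_(x in almost_periods F 2^-1) 4^-1)).
    rewrite sumr_const -[leRHS]mulr_natr mulrAC mulrC ler_wpM2l ?invr_ge0 //.
  rewrite [leRHS](bigID (mem (almost_periods F 2^-1))) /= -[leLHS]addr0.
  apply: lerD; last by apply: sumr_ge0 => x _; exact: exprn_ge0.
  apply: ler_sum => x; rewrite inE => /forallP/(_ 0); rewrite add0r F00 => Fx.
  rewrite (_ : 4^-1 = (2^-1) ^+ 2 :> C); last by field.
  rewrite ler_sqr ?nnegrE ?invr_ge0 //.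
  have := le_trans (lerB_dist 1 (1 - F x)) (lexx _).
  rewrite normr1 opprB addrCA subrr addr0; apply: le_trans.
  rewrite lerBrDl -lerBrDr distrC (le_trans Fx) // lerBrDr.
  by rewrite -mulr2n -[_ *+ 2]mulr_natr mulVf ?pnatr_eq0.
have cF d : d \in almost_periods F (a / 8) ->
    a / 8 * #|H|%:R <= `|autocorrelation F d|.
  rewrite inE => /forallP Fd.
  have -> : autocorrelation F d =
      \sum_x `|F x| ^+ 2 + \sum_x (F (x + d) - F x) * (F x)^*.
    by rewrite -big_split; apply: eq_bigr => x _ /=; rewrite normCK; ring.
  have err : `|\sum_x (F (x + d) - F x) * (F x)^*| <= a / 8 * #|H|%:R.
    apply: le_trans (ler_norm_sum _ _ _) _.
    rewrite mulr_natr -sumr_const; apply: ler_sum => x _.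
    rewrite normrM norm_conjC -[leRHS]mulr1; apply: ler_pM => //.
  have := lerB_normD (\sum_x `|F x| ^+ 2) (\sum_x (F (x + d) - F x) * (F x)^*).
  apply: le_trans; rewrite lerBrDr; apply: le_trans (lerD (lexx _) err) _.
  rewrite -mulrDl (_ : a / 8 + a / 8 = a / 4); last by field.
  by rewrite (le_trans sumF_ge) // ger0_norm // sumr_ge0 // => x _; exact: exprn_ge0.
have [||i Fi] := @large_fourier F ((a / 8) ^+ 2 * b) _ sumF_le.
- by rewrite mulr_gt0 ?exprn_gt0.
- rewrite (_ : _ * _ ^+ 3 = (b * #|H|%:R) * (a / 8 * #|H|%:R) ^+ 2); last by ring.
  apply: (@le_trans _ _ (\sum_(d in almost_periods F (a / 8)) (a / 8 * #|H|%:R) ^+ 2)).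
    by rewrite sumr_const -[leRHS]mulr_natl ler_wpM2r // exprn_ge0 // mulr_ge0 // ltW.
  rewrite [leRHS](bigID (mem (almost_periods F (a / 8)))) /= -[leLHS]addr0.
  apply: lerD; last by apply: sumr_ge0 => x _; exact: exprn_ge0.
  apply: ler_sum => d /cF cd.
  by rewrite ler_sqr ?nnegrE // mulr_ge0 // ltW.
(* The bound obtained is on the squared coefficient. The constant is at most 1, hence at least its
   own square, which replaces it before roots are taken. *)
exists i; rewrite -ler_sqr ?nnegrE //; last first.
  by rewrite !mulr_ge0 ?exprn_ge0 ?invr_ge0 // ltW.
apply: le_trans Fi; rewrite exprMn ler_wpM2r ?exprn_ge0 //.
rewrite expr2 -[leRHS]mulr1 ler_wpM2l //.
  by rewrite !mulr_ge0 ?exprn_ge0 ?invr_ge0 // ltW.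
have a81 : a / 8 <= 1.
  by rewrite ler_pdivrMr // mul1r (le_trans a1) // ler1n.
rewrite ler_pdivrMr // mul1r (le_trans (y := 1)) ?ler1n //.
by rewrite mulr_ile1 ?exprn_ge0 ?exprn_ile1 // ltW.
Qed.

End Fourier.
End FiniteCharacter.

(** * Characters of powers of a cyclic group *)

Lemma prim_root_exists (C : numClosedFieldType) n : (0 < n)%N ->
  exists z : C, n.-primitive_root z.
Proof.
move=> n0; have [r Dp] := closed_field_poly_normal ('X^n - 1 : {poly C}).
rewrite (monicP _) ?monicXnsubC // scale1r in Dp.
have rn1 : all n.-unity_root r by apply/allP => z; rewrite -root_prod_XsubC -Dp.
have sz_r : (n < (size r).+1)%N by rewrite -(size_prod_XsubC r id) -Dp size_XnsubC.
(* ['X^n - 1] is separable in characteristic 0, so its [n] roots are distinct and one of them is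
   primitive. *)
have [|z _ z_prim] := hasP (has_prim_root n0 rn1 _ sz_r); last by exists z.
by rewrite -separable_prod_XsubC -Dp separable_Xn_sub_1 // pnatr_eq0 -lt0n.
Qed.

Section PowerOfCyclic.
Variables (C : numClosedFieldType) (n k : nat) (w : C).
Hypothesis w_prim : n.+2.-primitive_root w.

Definition cyclic_character (j : {ffun 'I_k -> 'I_n.+2}) (x : 'rV['I_n.+2]_k) : C :=
  \prod_i w ^+ (j i * x 0 i).

Lemma cyclic_characterP j : character (cyclic_character j).
Proof.
have w1 : w ^+ n.+2 = 1 by exact: prim_expr_order.
split=> [x y|x].
  rewrite -big_split; apply: eq_bigr => i _ /=.
  rewrite mxE -exprD -mulnDr; apply/eqP.
  by rewrite (eq_prim_root_expr w_prim) modnMmr.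
rewrite normr_prod big1 // => i _; rewrite normrX.
have /eqP : `|w| ^+ n.+2 = 1 by rewrite -normrX w1 normr1.
by rewrite pexpr_eq1 // => /eqP ->; rewrite expr1n.
Qed.

(** The sum over [j] factors into one geometric sum per coordinate, and the factor at a coordinate
    with [x 0 i != 0] vanishes. *)
Lemma sum_cyclic_character x :
  \sum_j cyclic_character j x = (x == 0)%:R * #|{: 'rV['I_n.+2]_k}|%:R.
Proof.
rewrite -(bigA_distr_bigA (fun (i : 'I_k) (a : 'I_n.+2) => w ^+ (a * x 0 i))).
have [->|/eqP x0] := eqVneq x 0.
  rewrite mul1r card_mx mul1n card_ord natrX -[k in RHS]card_ord -prodr_const.
  apply: eq_bigr => i _; rewrite mxE /=.
  under eq_bigr do rewrite muln0 expr0.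
  by rewrite sumr_const card_ord.
have [i xi] : exists i, x 0 i != 0.
  apply/existsP; apply: contra_notT x0; rewrite negb_exists => /forallP x0.
  by apply/rowP => i; rewrite mxE; apply/eqP; rewrite -[_ == _]negbK.
rewrite mul0r (bigD1 i) //=; apply/eqP; rewrite mulf_eq0; apply/orP; left.
have wx : w ^+ x 0 i - 1 != 0.
  rewrite subr_eq0 -(expr0 w) (eq_prim_root_expr w_prim) mod0n modn_small //.
rewrite -(mulrI_eq0 _ (mulfI wx)).
under eq_bigr do rewrite mulnC exprM.
by rewrite -subrX1 exprAC (prim_expr_order w_prim) expr1n subrr.
Qed.

End PowerOfCyclic.

Lemma almost_periods_character (C : numClosedFieldType) n k
    (F : 'rV['I_n.+2]_k -> C) (a b : C) : 0 < a -> a <= 1 -> 0 < b -> b <= 1 ->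
    (forall x, `|F x| <= 1) -> F 0 = 1 ->
    a * #|{: 'rV['I_n.+2]_k}|%:R <= #|almost_periods F 2^-1|%:R ->
    b * #|{: 'rV['I_n.+2]_k}|%:R <= #|almost_periods F (a / 8)|%:R ->
  exists2 X : 'rV['I_n.+2]_k -> C, character X &
    (a / 8) ^+ 2 * b / 2 * #|{: 'rV['I_n.+2]_k}|%:R <= `|\sum_x F x * (X x)^*|.
Proof.
move=> a0 a1 b0 b1 F1 F0 aF bF; have [w wP] := prim_root_exists C (ltn0Sn n.+1).
have [j Fj] := almost_periods_fourier (cyclic_characterP wP)
  (sum_cyclic_character wP) a0 a1 b0 b1 F1 F0 aF bF.
by exists (cyclic_character w j) => //; exact: cyclic_characterP.
Qed.

(** * Characters of compact abelian groups *)

Lemma compact_finite_selection (X : topologicalType) (I : eqType)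
    (P : I -> set X) :
  compact [set: X] -> (forall x : X, exists i, nbhs x (P i)) ->
  exists s : seq I, forall x, exists2 i, i \in s & P i x.
Proof.
move=> cX Pnbhs.
(* The filter of lists under inclusion: the near-covering form of compactness, applied to it, yields
   one list that serves all points. *)
pose F := filter_from [set: seq I] (fun s0 => [set s : seq I | {subset s0 <= s}]).
have FF : Filter F.
  apply: filter_from_filter; first by exists [::].
  move=> s t _ _; exists (s ++ t) => // u /= stu; split=> x xu; apply: stu;
    by rewrite mem_cat xu ?orbT.
have [/= s0 _ s0P] : F [set s : seq I | [set: X] `<=`
    [set x | exists2 i, i \in s & P i x]].
  apply: (iffLR (compact_near_coveringP _)) FF _ => // x _.
  have [i Pix] := Pnbhs x.
  exists (P i, [set s : seq I | i \in s]) => /=.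
    by split => //; exists [:: i] => // s si; apply: si; rewrite inE.
  by move=> [y s] /= [Py si]; exists i.
by exists s0 => x; exact: (s0P s0).
Qed.

Section CompactGroup.
Variables (R : realType) (G : topologicalZmodType).
Hypotheses (cG : compact [set: G]) (hG : hausdorff_space G).

(** Uniform continuity: compactness makes the neighbourhood of 0 independent of [y]. *)
Lemma near_shift (f : G -> R) (e : R) : continuous f -> 0 < e ->
  \forall v \near (0 : G), forall y, `|f (y + v) - f y| <= e.
Proof.
move=> cf e0.
have /compact_near_coveringP/(_ _ (nbhs (0 : G))
  (fun v y => `|f (y + v) - f y| <= e)) := cG.
move=> /(_ _ _)/wrap[|H]; last by apply: filterS H => v + y; apply.
move=> x _.
have c1 : (fun p : G * G => f (p.1 + p.2) - f p.1) @ (x, 0 : G) --> f (x + 0) - f x.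
  apply: cvgB.
    exact: (cvg_comp _ _ (@add_continuous G (x, 0)) (cf (x + 0))).
  exact: (cvg_comp _ _ (@cvg_fst _ _ (nbhs x) (nbhs (0 : G)) _) (cf x)).
rewrite addr0 subrr in c1.
have /cvgr0Pnorm_le/(_ _ e0) := c1.
by [].
Unshelve. all: by end_near. Qed.

Lemma near_combination (V : set G) : nbhs 0 V ->
  exists2 W : set G, nbhs 0 W &
    forall a b c, W a -> W b -> W c -> V (a + b - c).
Proof.
move=> V0.
have c1 : (fun p : (G * G) * G => p.1.1 + p.1.2 - p.2) @
    ((0 : G, 0 : G), 0 : G) --> (0 + 0 - 0 : G).
  apply: (cvg_comp (fun p : (G * G) * G => (p.1.1 + p.1.2, p.2))
    (fun p : G * G => p.1 - p.2) _ (@sub_continuous G (0 + 0, 0))).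
  apply: cvg_pair; last exact: cvg_snd.
  apply: (cvg_comp fst (fun p : G * G => p.1 + p.2)); first exact: cvg_fst.
  exact: (@add_continuous G (0, 0)).
have : nbhs (0 + 0 - 0 : G) V by rewrite addr0 subr0.
move=> /c1 [[/= A B] [[[/= A1 A2] [A10 A20] A12] B0] AB].
exists (A1 `&` A2 `&` B); first by repeat apply: filterI.
move=> a b c [[aA _] _] [[_ bA] _] [_ cB].
by apply: (AB ((a, b), c)); split => //; apply: A12.
Qed.

Lemma near_translate (V : set G) (y : G) : nbhs 0 V -> \forall y' \near y, V (y' - y).
Proof.
move=> V0; suff cy : (fun y' => y' - y) @ y --> y - y by apply: cy; rewrite subrr.
apply: (cvg_comp (fun y' => (y', y)) _ _ (@sub_continuous G (y, y))).
by apply: cvg_pair; [exact: cvg_id|exact: cvg_cst].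
Qed.

Lemma total_boundedness (V : set G) : nbhs 0 V ->
  exists s : seq G, forall y, exists2 x, x \in s & V (y - x).
Proof.
move=> V0; apply: (compact_finite_selection (P := fun x => [set y | V (y - x)])) => //.
by move=> x; exists x; exact: near_translate.
Qed.

Lemma near_difference (V : set G) : nbhs 0 V ->
  exists2 W : set G, nbhs 0 W & forall a b, W a -> W b -> V (a - b).
Proof.
move=> /near_combination[W W0 WV]; exists W => // a b Wa Wb.
by have := WV a 0 b Wa (nbhs_singleton W0) Wb; rewrite addr0.
Qed.

(** * Recurrence and approximation by finite groups *)

Lemma finite_coloring (V : set G) : nbhs 0 V ->
  exists k, exists c : G -> 'I_k, forall y y', c y = c y' -> V (y - y').
Proof.
(* The colour of [y] is the index of a centre [x] with [y - x] in [W]; for a common centre these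
   differences subtract to [y - y']. *)
move=> /near_difference[W /total_boundedness[s sP] WV].
have /choice[x xP] y : exists x, x \in s /\ W (y - x).
  by have [x ? ?] := sP y; exists x.
have xs y : (index (x y) s < size s)%N by rewrite index_mem; case: (xP y).
exists (size s), (fun y => Ordinal (xs y)) => y y' /(congr1 val) /= E.
have {}E : x y = x y'.
  by rewrite -[LHS](nth_index 0 (xP y).1) E nth_index //; case: (xP y').
have [_ yx] := xP y; have [_ y'x] := xP y'.
by have := WV _ _ yx y'x; rewrite E opprB addrA subrK.
Qed.

(** Pigeonhole on the vectors of colours of a common multiple of all the [g i]. *)
Lemma simultaneous_recurrence (I : finType) (g : I -> G) (V : set G) :
  nbhs 0 V -> exists n, forall i, V (g i *+ n.+2).
Proof.
move=> /finite_coloring[k [c cV]].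
(* Only even multiples are coloured, so that two distinct ones differ by at least 2, that is by some
   [n.+2]. *)
pose col (m : 'I_(#|{ffun I -> 'I_k}|).+1) := [ffun i => c (g i *+ (2 * m))].
have /injectivePn[m [m' mm' E]] : ~~ injectiveb col.
  by apply/negP => /injectiveP/leq_card; rewrite card_ord ltnn.
wlog lt_mm' : m m' mm' E / (m' < m)%N.
  move=> H; have := mm'; rewrite neq_ltn => /orP[] /H; last by apply.
  by rewrite eq_sym; apply.
exists (2 * (m - m').-1)%N => i.
have -> : (2 * (m - m').-1).+2 = (2 * m - 2 * m')%N.
  by rewrite -mulnBr -(prednK (n := m - m')) ?subn_gt0 // mulnS.
rewrite mulrnBr ?leq_mul2l ?(ltnW lt_mm') ?orbT //; apply: cV.
by move/ffunP/(_ i): E; rewrite !ffunE.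
Qed.

Definition approx_hom (H : zmodType) (V : set G) (phi : H -> G) :=
  forall x y, V (phi x + phi y - phi (x + y)).

(** Translating a colour class by minus one of its elements lands in the set of return times, so
    none of the [k] classes is larger than this set. As [k] and [W] are chosen before [H], the
    proportion is uniform. *)
Lemma return_times (V : set G) : nbhs 0 V ->
  exists k, exists2 W : set G, nbhs 0 W &
    forall (H : finZmodType) (phi : H -> G), approx_hom W phi ->
      (#|H| <= k * #|[set u | `[< V (phi u) >]]%SET|)%N.
Proof.
move=> /near_difference[W W0 WV]; have [k [c cW]] := finite_coloring W0.
exists k, W => // H phi aphi.
pose D := [set u | `[< V (phi u) >]]%SET.
have -> : #|H| = (\sum_(j < k) \sum_(x | c (phi x) == j) 1)%N.
  by rewrite -sum1_card (partition_big (c \o phi) predT).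
apply: leq_trans (_ : \sum_(j < k) #|D| <= _)%N; last by rewrite sum_nat_const card_ord.
apply: leq_sum => j _.
have [x /eqP xj|] := pickP (fun x => c (phi x) == j); last first.
  by move=> none; rewrite big_pred0.
rewrite sum1_card -(card_imset _ (addIr (- x))); apply: subset_leq_card.
apply/fintype.subsetP => _ /imsetP[y /eqP yj ->]; rewrite inE; apply/asboolP.
have a := aphi x (y - x); rewrite (addrC x) subrK in a.
have b : W (phi x - phi y) by apply: cW; apply: val_inj; rewrite yj xj.
have := WV _ _ a b.
by rewrite opprB addrA subrK addrAC subrr add0r.
Qed.

(** [phi] forms the combinations of [L] with coefficients below [n.+2]. Its additivity fails only
    through carries, by [n.+2] times the sum of the entries of [L] where a carry occurs; recurrence
    for all such subset sums makes this small. *)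
Lemma cyclic_approximation (L : seq G) (V : set G) : nbhs 0 V ->
  exists n k, exists phi : 'rV['I_n.+2]_k -> G, exists s : G -> 'rV['I_n.+2]_k,
    [/\ approx_hom V phi, phi 0 = 0 & forall g, g \in L -> phi (s g) = g].
Proof.
move=> V0; pose k := size L.
have [n nV] := simultaneous_recurrence (fun J : {set 'I_k} => \sum_(i in J) L`_i) V0.
pose phi (x : 'rV['I_n.+2]_k) := \sum_(i < k) L`_i *+ x 0 i.
exists n, k, phi, (fun g => \row_(i < k) (i == index g L :> nat)%:R); split.
- move=> x y.
  pose J := [set i | (n.+2 <= x 0%R i + y 0%R i)%N]%SET.
  have := nV J; rewrite -sumrMnl.
  congr V; rewrite /phi -big_split -sumrB big_mkcond; apply: eq_bigr => i _ /=.
  rewrite mxE inE -mulrnDr; set m := (_ + _)%N.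
  have -> : (x 0 i + y 0 i : 'I_n.+2) = (m %% n.+2)%N :> nat by [].
  have [lt_mn|le_nm] := ltnP m n.+2; first by rewrite modn_small // subrr.
  rewrite -[m in RHS](subnK le_nm) modnDr modn_small; last first.
    by rewrite ltn_subLR // /m -addSn leq_add // ltnW.
  by rewrite mulrnDr addrAC addrN add0r.
- by rewrite /phi big1 // => i _; rewrite mxE mulr0n.
- move=> g gL; have gk : (index g L < k)%N by rewrite index_mem.
  rewrite /phi (bigD1 (Ordinal gk)) //= big1 => [|i ni].
    by rewrite mxE eqxx addr0 nth_index // mulr1n.
  by rewrite mxE -val_eqE in ni *; rewrite (negPf ni) mulr0n.
Qed.

(** * Approximate characters *)

Local Notation "x %:C" := (real_complex R x) : ring_scope.
Local Notation normc := (@ComplexField.Normc.normc R).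

Lemma almost_periods_dense (h : G -> R) (e : R) : continuous h -> 0 < e ->
  exists a : R, [/\ 0 < a, a <= 1 & exists2 W : set G, nbhs 0 W &
    forall (H : finZmodType) (phi : H -> G), approx_hom W phi ->
      a%:C * #|H|%:R <= #|almost_periods (fun x => (h (phi x))%:C) e%:C|%:R].
Proof.
move=> ch e0; have [D D0 DP] := near_difference (near_shift ch e0).
have [k [W W0 WP]] := return_times D0.
(* The successor keeps the inverse positive even for [k = 0]. *)
exists k.+1%:R^-1; split; first by rewrite invr_gt0.
  by rewrite invf_le1 // ler1n.
exists (W `&` D); first exact: filterI.
move=> H phi aphi; rewrite fmorphV rmorph_nat /= ler_pdivrMl // -natrM ler_nat.
have /WP le_H : approx_hom W phi by move=> x y; case: (aphi x y).
apply: leq_trans le_H _; apply: leq_mul => //; apply: subset_leq_card.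
apply/fintype.subsetP => u; rewrite !inE => Du.
apply/forallP => x.
rewrite -rmorphB normc_def /= expr0n addr0 sqrtr_sqr lecR.
(* [phi (x + u) - phi x] is [phi u] minus the additivity defect at [x] and [u], and both lie in
   [D]. *)
have [_ Dx] := aphi x u; have := DP _ _ Du Dx (phi x).
by congr (`|h _ - _| <= _); rewrite opprB addrA addrCA subrr addr0.
Qed.

(** A character up to the error [e] on the finite list [L]. The third clause is a modulus of
    continuity inherited from [h], the fourth keeps [X g0] away from 1; with one [c] for all [L] and
    [e], both survive a limit. *)
Definition approx_character (h : G -> R) (g0 : G) (c : R) (L : seq G) (e : R)
    (X : G -> R[i]) : Prop :=
  [/\ forall g, normc (X g) = 1,
      forall g g', g \in L -> g' \in L -> g + g' \in L ->
        normc (X (g + g') - X g * X g') <= e,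
      forall g d, g \in L -> (forall y, `|h (y + g) - h y| <= d) ->
        c * normc (X g - 1) <= d + e &
      g0 \in L -> c / 2 <= normc (X g0 - 1)].

Lemma normrE (z : R[i]) : `|z| = (normc z)%:C.
Proof. by []. Qed.

Lemma normcR (x : R) : normc x%:C = `|x|.
Proof. by rewrite /= expr0n addr0 sqrtr_sqr. Qed.

(** A character of a finite group at which [h \o phi] has a large coefficient is carried to [L] by
    the section [s]. The densities [a] and [b], hence [c], depend on [h] alone. *)
Lemma approx_character_exists (f : G -> R) (g0 : G) : continuous f ->
    (forall y, 0 <= f y <= 1) -> f 0 = 0 -> f g0 = 1 ->
  exists2 c, 0 < c & forall L e, 0 < e ->
    exists X, approx_character (fun y => f (y + g0) - f y) g0 c L e X.
Proof.
move=> cf f01 f0 fg0; pose h y := f (y + g0) - f y.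
have ch : continuous h.
  move=> y; apply: cvgB; last exact: cf.
  apply: (cvg_comp (fun y => y + g0) f _ (cf (y + g0))).
  apply: (cvg_comp (fun y => (y, g0)) _ _ (@add_continuous G (y, g0))).
  by apply: cvg_pair; [exact: cvg_id|exact: cvg_cst].
have h1 y : `|h y| <= 1.
  by have := f01 y; have := f01 (y + g0); rewrite /h ler_norml; lra.
have h0 : h 0 = 1 by rewrite /h add0r f0 fg0 subr0.
have half0 : 0 < 2^-1 :> R by rewrite invr_gt0.
have [a [a0 a1 [Wa Wa0 aP]]] := almost_periods_dense ch half0.
have a80 : 0 < a / 8 by rewrite divr_gt0.
have [b [b0 b1 [Wb Wb0 bP]]] := almost_periods_dense ch a80.
pose c := (a / 8) ^+ 2 * b / 2.
have c0 : 0 < c by rewrite divr_gt0 // mulr_gt0 // exprn_gt0.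
exists c => // L e e0.
(* [e] is the slack of the displacement clause; [c * e] serves multiplicativity, where the factor
   [c] is cancelled. *)
have m0 : 0 < Num.min e (c * e) by rewrite lt_min e0 mulr_gt0.
have c20 : 0 < c / 2 by rewrite divr_gt0.
have [W W0 WP] := near_combination (filterI (near_shift ch m0) (near_shift cf c20)).
have [n [k [phi [s [aphi phi0 phis]]]]] := cyclic_approximation (g0 :: L)
  (filterI (filterI Wa0 Wb0) W0).
have aphiW : approx_hom W phi by move=> x y; case: (aphi x y).
have W00 := nbhs_singleton W0.
pose F x := (h (phi x))%:C.
have [|||||||| X cX Xc] := @almost_periods_character R[i] n k F a%:C b%:C.
- by rewrite ltcR.
- by rewrite -(rmorph1 (real_complex R)) lecR.
- by rewrite ltcR.
- by rewrite -(rmorph1 (real_complex R)) lecR.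
- by move=> x; rewrite normrE normcR -(rmorph1 (real_complex R)) lecR.
- by rewrite /F phi0 h0.
- rewrite -(rmorph_nat (real_complex R) 2) -fmorphV.
  by apply: aP => x y; case: (aphi x y) => -[].
- rewrite -(rmorph_nat (real_complex R) 8) -fmorph_div.
  by apply: bP => x y; case: (aphi x y) => -[].
have disp u d : (forall x, `|h (phi (x + u)) - h (phi x)| <= d) ->
    c * normc (X u - 1) <= d.
  move=> hd; suff : c%:C * `|X u - 1| <= d%:C by rewrite normrE -rmorphM lecR.
  apply: (character_displacement cX (F := F)).
  - by rewrite lecR ltW.
  - have -> : c%:C = (a%:C / 8) ^+ 2 * b%:C / 2; last exact: Xc.
    by rewrite /c !(rmorphM, fmorphV, rmorphXn, rmorph_nat).
  - by move=> x; rewrite -rmorphB normrE normcR lecR.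
have phisL g : g \in L -> phi (s g) = g.
  by move=> gL; apply: phis; rewrite inE gL orbT.
have shift x g : g \in g0 :: L -> exists2 w, W w & phi (x + s g) = phi x + g - w.
  move=> gL; exists (phi x + g - phi (x + s g)).
    by have := aphiW x (s g); rewrite phis.
  by rewrite opprB addrCA subrr addr0.
pose Y g := if g \in L then X (s g) else 1.
exists Y; split.
- move=> g; have /eqP : `|Y g| = 1.
    by rewrite /Y; case: ifP => _; rewrite ?normr1 // character_norm.
  by rewrite normrE eq_complex /= => /andP[/eqP].
- move=> g g' gL g'L gg'L; rewrite /Y gL g'L gg'L.
  (* [u] is the failure of [s] to be additive. Three additivity defects of [phi] combine to
     [phi (x + u) - phi x], so [u] is an almost period and [X u] is within [e] of 1. *)
  pose u := s (g + g') - (s g + s g').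
  have us : u + (s g + s g') = s (g + g') by rewrite subrK.
  have -> : X (s (g + g')) - X (s g) * X (s g') = X (s g + s g') * (X u - 1).
    by rewrite -us (characterD cX u) (characterD cX (s g)) mulrBr mulr1 mulrC.
  rewrite ComplexField.Normc.normcM.
  have -> : normc (X (s g + s g')) = 1.
    have /eqP := character_norm cX (s g + s g').
    by rewrite normrE eq_complex /= => /andP[/eqP].
  rewrite mul1r -(ler_pM2l c0); apply: disp => x.
  have := WP _ _ _ (aphiW u (s g + s g')) (aphiW (s g) (s g')) (aphiW x u).
  rewrite us !phisL // => -[/(_ (phi x)) + _].
  rewrite le_min => /andP[_]; congr (`|h _ - _| <= _).
  rewrite [phi u + _ - _ + _]addrA subrK addrK opprB addrA addrCA subrr addr0 //.
- move=> g d gL hd; rewrite /Y gL; apply: disp => x.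
  have [|w Ww ->] := shift x g; first by rewrite inE gL orbT.
  have [/(_ (phi x + g)) + _] := WP _ _ _ W00 W00 Ww.
  rewrite !add0r le_min => /andP[+ _] => hw.
  rewrite [d + e]addrC; apply: le_trans (lerD hw (hd (phi x))).
  by rewrite -[leLHS](congr1 Num.norm (subrKA (h (phi x + g)) _ _)) ler_normD.
(* [F] is within [c / 2] of [F' (x + u) - F' x], whose coefficient is [X u - 1] times that of [F'].
   The coefficient of [F] is at least [c * K] and that of [F'] at most [K], so [X u] has distance at
   least [c / 2] from 1. *)
- move=> g0L; rewrite /Y g0L.
  set u := s g0; pose K : R[i] := #|{: 'rV['I_n.+2]_k}|%:R.
  have K0 : 0 < K by rewrite ltr0n; apply/card_gt0P; exists 0.
  pose F' x := (f (phi x))%:C.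
  have sumK (E : 'rV['I_n.+2]_k -> R[i]) d : (forall x, `|E x| <= d) ->
      `|\sum_x E x * (X x)^*| <= d * K.
    move=> Ed; apply: le_trans (ler_norm_sum _ _ _) _.
    rewrite mulr_natr -sumr_const; apply: ler_sum => x _.
    by rewrite normrM norm_conjC character_norm // mulr1.
  have F'1 x : `|F' x| <= 1.
    rewrite normrE normcR -(rmorph1 (real_complex R)) lecR.
    by have := f01 (phi x); rewrite ler_norml; lra.
  have E2 x : `|F x - (F' (x + u) - F' x)| <= (c / 2)%:C.
    rewrite -!rmorphB normrE normcR lecR /h.
    have [|w Ww ->] := shift x g0; first by rewrite inE eqxx.
    have [_ /(_ (phi x + g0))] := WP _ _ _ W00 W00 Ww.
    by rewrite !add0r distrC; congr (`|_| <= _); ring.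
  have : c%:C * K <= `|X u - 1| * K + (c / 2)%:C * K.
    apply: (@le_trans _ _ `|\sum_x F x * (X x)^*|).
      have -> : c%:C = (a%:C / 8) ^+ 2 * b%:C / 2; last exact: Xc.
      by rewrite /c !(rmorphM, fmorphV, rmorphXn, rmorph_nat).
    have -> : \sum_x F x * (X x)^* = (X u - 1) * (\sum_x F' x * (X x)^*) +
        \sum_x (F x - (F' (x + u) - F' x)) * (X x)^*.
      rewrite -character_shift // -big_split; apply: eq_bigr => x _ /=; ring.
    apply: le_trans (ler_normD _ _) _; apply: lerD; last exact: sumK.
    by rewrite normrM ler_wpM2l // -[K]mul1r sumK.
  rewrite -mulrDl (ler_pM2r K0) normrE -rmorphD lecR; lra.
Qed.

(** * Passage to the limit *)

Lemma normc_le (z : R[i]) : normc z <= `|complex.Re z| + `|complex.Im z|.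
Proof.
case: z => a b /=; rewrite -[leRHS]ger0_norm ?addr_ge0 // -sqrtr_sqr ler_wsqrtr //.
by rewrite sqrrD !real_normK ?num_real // addrAC lerDl mulrn_wge0 // mulr_ge0.
Qed.

Lemma approx_characterS h g0 c L L' e e' X : {subset L <= L'} -> e' <= e ->
  approx_character h g0 c L' e' X -> approx_character h g0 c L e X.
Proof.
move=> sL le_e [X1 XD Xh Xg0]; split=> //.
- move=> g g' gL g'L gg'L; apply: le_trans le_e.
  by apply: XD; exact: sL.
- move=> g d gL hd; apply: (@le_trans _ _ (d + e')); last by rewrite lerD2l.
  by apply: Xh => //; exact: sL.
- by move=> /sL.
Qed.

(** Real and imaginary parts are stored under the two booleans, so that Tychonoff applies to a
    product of real segments. *)
Let complex_of (Y : G * bool -> R) g : R[i] := Complex (Y (g, true)) (Y (g, false)).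

(** The sets of approximate characters for all [(L, e)] generate a filter on a compact cube, and [X]
    is a cluster point of it. *)
Lemma limit_character h g0 c :
    (forall L e, 0 < e -> exists X, approx_character h g0 c L e X) ->
  exists X : G -> R[i], forall L e, 0 < e -> exists2 X', approx_character h g0 c L e X' &
    forall g, g \in L -> normc (X' g - X g) <= e.
Proof.
move=> exX.
pose A := [set Y : {ptws G * bool -> R} | forall i, `[-1, 1]%classic (Y i)].
have cA : compact A.
  apply: (@tychonoff (G * bool)%type (fun _ => R : topologicalType)
    (fun _ => `[-1, 1]%classic)) => i.
  exact: segment_compact.
pose S (p : seq G * R) := [set Y : {ptws G * bool -> R} |
  approx_character h g0 c p.1 p.2 (complex_of Y)].
pose Fil := filter_from [set p : seq G * R | 0 < p.2] S.
have FF : ProperFilter Fil.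
  apply: filter_from_proper; last first.
    move=> [L e] /= /(exX L)[X XP].
    exists (fun i => if i.2 then complex.Re (X i.1) else complex.Im (X i.1)).
    have : complex_of (fun i => if i.2 then complex.Re (X i.1)
                                else complex.Im (X i.1)) = X.
      by apply: funext => g; rewrite /complex_of /=; case: (X g).
    by rewrite /S /= => ->.
  apply: filter_from_filter; first by exists ([::], 1) => /=.
  move=> [L e] [L' e'] /= e0 e'0; exists (L ++ L', Num.min e e') => /=.
    by rewrite lt_min e0.
  move=> Y YP; split; apply: approx_characterS YP.
  - by move=> g gL; rewrite mem_cat gL.
  - by rewrite ge_min lexx.
  - by move=> g gL; rewrite mem_cat gL orbT.
  - by rewrite ge_min lexx orbT.
have FA : Fil A.
  exists ([::], 1) => //= Y [Y1 _ _ _] [g b].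
  have : `|Y (g, true)| ^+ 2 + `|Y (g, false)| ^+ 2 = 1.
    have := Y1 g; rewrite /= !real_normK ?num_real // => /(congr1 (fun x => x ^+ 2)).
    by rewrite expr1n sqr_sqrtr // addr_ge0 // sqr_ge0.
  rewrite /= in_itv /= -ler_norml -(expr_le1 (n := 2)) //.
  by case: b; have := sqr_ge0 `|Y (g, true)|; have := sqr_ge0 `|Y (g, false)|; lra.
have [Y [_ clY]] := cA Fil FF FA.
exists (complex_of Y) => L e e0.
have e20 : 0 < e / 2 by rewrite divr_gt0.
have nearY i : \forall Z \near Y, `|Z i - Y i| < e / 2.
  have pY : (fun Z : {ptws G * bool -> R} => Z i) @ Y --> Y i.
    exact: (@proj_continuous _ (fun _ : G * bool => R) i Y).
  have /cvgrPdist_lt/(_ _ e20) := pY.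
  by apply: filterS => Z; rewrite distrC.
have {}nearY : \forall Z \near Y, forall g, g \in L ->
    forall b, `|Z (g, b) - Y (g, b)| < e / 2.
  elim: (L) => [|g L' IH]; first by near=> Z.
  near=> Z => g'; rewrite inE => /orP[/eqP -> [] | g'L].
  - by near: Z; exact: nearY.
  - by near: Z; exact: nearY.
  - by move: g' g'L; near: Z.
have [|Z [SZ ZY]] := clY (S (L, e)) _ _ nearY; first by exists (L, e).
exists (complex_of Z) => // g gL.
have := ler_ltD (ltW (ZY g gL true)) (ZY g gL false).
rewrite -splitr => /ltW; apply: le_trans.
exact: normc_le.
Unshelve. all: by end_near. Qed.

Let normc_ge0 (z : R[i]) : 0 <= normc z.
Proof.
have := normr_ge0 z.
by rewrite normrE -[0 in X in X -> _](rmorph0 (real_complex R)) lecR.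
Qed.

Let normcB (x y : R[i]) : normc (x - y) = normc (y - x).
Proof.
by have [] : (normc (x - y))%:C = (normc (y - x))%:C by rewrite -!normrE distrC.
Qed.

Let normcD (x y z : R[i]) : normc (x - z) <= normc (x - y) + normc (y - z).
Proof. by rewrite -lecR rmorphD -!normrE ler_distD. Qed.

(** A Urysohn function for 0 and [g0] supplies [f]. Each property of the limit is read off
    approximations on a list of at most three points. *)
Lemma separating_character (g0 : G) : g0 != 0 ->
  exists X : G -> R[i], [/\ forall g, normc (X g) = 1,
    forall g g', X (g + g') = X g * X g',
    forall e, 0 < e -> \forall g \near 0, normc (X g - 1) <= e &
    X g0 != 1].
Proof.
move=> g00.
have nG : normal_space G by exact: compact_normal.
have sep : uniform_separator [set (0 : G)] [set g0].
  apply: (iffLR (@normal_separatorP R G)) nG _ _ _ _ _.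
  - exact/accessible_closed_set1/hausdorff_accessible.
  - exact/accessible_closed_set1/hausdorff_accessible.
  - by rewrite -subset0 => y [-> /= /esym/eqP]; rewrite (negPf g00).
have /uniform_separatorP-/(_ R)[f [cf f01 f0 f1]] := sep.
have {}f01 y : 0 <= f y <= 1 by have /f01 := imageT f y; rewrite /= in_itv.
have {}f0 : f 0 = 0 by apply: f0; exists 0.
have {}f1 : f g0 = 1 by apply: f1; exists g0.
have [c c0 /limit_character[X XP]] := approx_character_exists cf f01 f0 f1.
have X1 g : normc (X g) = 1.
  apply/eqP; rewrite eq_le; apply/andP; split; apply/ler_addgt0Pl => e e0.
    have [X' [X1 _ _ _] /(_ g (mem_head _ _)) Xg] := XP [:: g] e e0.
    have := normcD (X g) (X' g) 0; rewrite !subr0 normcB X1 => h.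
    by apply: le_trans h _; rewrite lerD2r.
  have [X' [X1 _ _ _] /(_ g (mem_head _ _)) Xg] := XP [:: g] e e0.
  have := normcD (X' g) (X g) 0; rewrite !subr0 X1 => h.
  by apply: le_trans h _; rewrite lerD2r.
have XD g g' : X (g + g') = X g * X g'.
  apply/eqP; rewrite -subr_eq0; apply/eqP/ComplexField.Normc.eq0_normc.
  apply/eqP; rewrite eq_le normc_ge0 andbT.
  apply/ler_addgt0Pl => e e0; rewrite addr0.
  (* Four errors add up on the way from [X (g + g')] through [X' (g + g')], [X' g * X' g'] and
     [X' g * X g'] to [X g * X g']. *)
  have e40 : 0 < e / 4 by rewrite divr_gt0.
  have [X' [X'1 X'D _ _] XX'] := XP [:: g; g'; g + g'] _ e40.
  have gL : g \in [:: g; g'; g + g'] by rewrite !inE eqxx.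
  have g'L : g' \in [:: g; g'; g + g'] by rewrite !inE eqxx ?orbT.
  have gg'L : g + g' \in [:: g; g'; g + g'] by rewrite !inE eqxx ?orbT.
  have h1 := XX' _ gg'L; rewrite normcB in h1.
  have h2 := X'D _ _ gL g'L gg'L.
  have h3 : normc (X' g * X' g' - X' g * X g') <= e / 4.
    by rewrite -mulrBr ComplexField.Normc.normcM X'1 mul1r XX'.
  have h4 : normc (X' g * X g' - X g * X g') <= e / 4.
    by rewrite -mulrBl ComplexField.Normc.normcM X1 mulr1 XX'.
  have := normcD (X (g + g')) (X' (g + g')) (X g * X g').
  have := normcD (X' (g + g')) (X' g * X' g') (X g * X g').
  have := normcD (X' g * X' g') (X' g * X g') (X g * X g').
  move: h1 h2 h3 h4.
  set n1 := normc _; set n2 := normc _; set n3 := normc _; set n4 := normc _.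
  set n5 := normc _; set n6 := normc _; set n7 := normc _; lra.
have Xh g d : (forall y, `|f (y + g + g0) - f (y + g) - (f (y + g0) - f y)| <= d) ->
    c * normc (X g - 1) <= d.
  move=> hd; apply/ler_addgt0Pl => e e0.
  (* The error enters once with factor [c], from [X g - X' g], and once with factor 1, from the
     displacement clause. *)
  have e10 : 0 < e / (c + 1) by rewrite divr_gt0 // addr_gt0.
  have [X' [_ _ X'h _] /(_ g (mem_head _ _)) Xg] := XP [:: g] _ e10.
  have {}X'h := X'h g d (mem_head _ _) hd; rewrite normcB in Xg.
  have h := normcD (X g) (X' g) 1.
  apply: le_trans (ler_wpM2l (ltW c0) h) _; rewrite mulrDr.
  apply: le_trans (lerD (ler_wpM2l (ltW c0) Xg) X'h) _.
  rewrite addrCA addrC lerD2r -[X in _ + X]mul1r -mulrDl mulrCA divff ?mulr1 //.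
  by rewrite gt_eqF // addr_gt0.
exists X; split=> //.
- move=> e e0; have ce0 : 0 < c * e / 2 by rewrite divr_gt0 // mulr_gt0.
  near=> g; rewrite -(ler_pM2l c0); apply: Xh => y.
  have fg : forall y, `|f (y + g) - f y| <= c * e / 2.
    by near: g; exact: near_shift.
  rewrite (addrAC y); have := fg (y + g0); have := fg y; rewrite !ler_norml => H1 H2.
  have -> : f (y + g0 + g) - f (y + g) - (f (y + g0) - f y) =
    (f (y + g0 + g) - f (y + g0)) - (f (y + g) - f y) by ring.
  by lra.
- apply: contraT => /negPn/eqP X1g0.
  have c40 : 0 < c / 4 by rewrite divr_gt0.
  have [X' [_ _ _ X'g0] /(_ g0 (mem_head _ _))] := XP [:: g0] _ c40.
  by have := X'g0 (mem_head _ _); rewrite X1g0; lra.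
Unshelve. all: by end_near. Qed.

Theorem circle_character (g0 : G) : g0 != 0 ->
  exists a b : G -> R, [/\ continuous a, continuous b,
    forall g g', a (g + g') = a g * a g' - b g * b g' /\
                 b (g + g') = a g * b g' + b g * a g',
    forall g, a g ^+ 2 + b g ^+ 2 = 1 & a g0 != 1].
Proof.
move=> /separating_character[X [X1 XD Xc Xg0]].
have XE g : X g = Complex (complex.Re (X g)) (complex.Im (X g)) by case: (X g).
have XB g g' : normc (X g' - X g) = normc (X (g' - g) - 1).
  have -> : X g' = X g * X (g' - g) by rewrite -XD addrC subrK.
  rewrite -{2}[X g]mulr1 -mulrBr.
  by rewrite ComplexField.Normc.normcM X1 mul1r.
have sq g : complex.Re (X g) ^+ 2 + complex.Im (X g) ^+ 2 = 1.
  have := X1 g; rewrite {1}XE /= => /(congr1 (fun x => x ^+ 2)).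
  by rewrite expr1n sqr_sqrtr // addr_ge0 // sqr_ge0.
have Re_le z : `|complex.Re z| <= normc z.
  by case: z => u v /=; rewrite -sqrtr_sqr ler_wsqrtr // lerDl sqr_ge0.
have Im_le z : `|complex.Im z| <= normc z.
  by case: z => u v /=; rewrite -sqrtr_sqr ler_wsqrtr // lerDr sqr_ge0.
have Xcvg g e : 0 < e -> \forall g' \near g, normc (X g - X g') <= e.
  move=> /Xc/(near_translate g); apply: filterS => g' /=.
  by rewrite -XB normcB.
exists (fun g => complex.Re (X g)), (fun g => complex.Im (X g)); split.
- move=> g; apply/cvgrPdist_le => e /(Xcvg g); apply: filterS => g' /=.
  by apply: le_trans; apply: le_trans (Re_le _); case: (X g) (X g') => ? ? [].
- move=> g; apply/cvgrPdist_le => e /(Xcvg g); apply: filterS => g' /=.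
  by apply: le_trans; apply: le_trans (Im_le _); case: (X g) (X g') => ? ? [].
- move=> g g'; rewrite /= XD; case: (X g) => u v; case: (X g') => u' v' /=.
  by rewrite [_ + v * u']addrC addrC.
- exact: sq.
- apply: contra Xg0 => /= /eqP a1; rewrite XE a1.
  have := sq g0; rewrite a1 expr1n => /eqP.
  by rewrite addrC -subr_eq0 addrK sqrf_eq0 => /eqP ->.
Qed.

End CompactGroup.

Local Close Scope ring_scope.

(** * Closed congruences *)

Lemma hausdorff_setX (X Y : topologicalType) :
  hausdorff_space X -> hausdorff_space Y -> hausdorff_space (X * Y)%type.
Proof.
move=> hX hY [x y] [x' y'] clxy; congr pair.
  apply: hX => A B Ax Bx'.
  have [||[u v] [/= ? ?]] := clxy (A `*` setT) (B `*` setT).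
  - by exists (A, setT) => //; split => //; exact: filterT.
  - by exists (B, setT) => //; split => //; exact: filterT.
  - by exists u; split; tauto.
apply: hY => A B Ax Bx'.
have [||[u v] [/= ? ?]] := clxy (setT `*` A) (setT `*` B).
- by exists (setT, A) => //; split => //; exact: filterT.
- by exists (setT, B) => //; split => //; exact: filterT.
- by exists v; split; tauto.
Qed.

Lemma closed_diagonal (X : topologicalType) : hausdorff_space X ->
  closed [set p : X * X | p.1 = p.2].
Proof.
move=> hX [x y] clxy; apply: hX => A B Ax By.
have [|[u v] [/= <- [Au Bu]]] := clxy (A `*` B); first by exists (A, B).
by exists u.
Qed.

Lemma continuous_pair (X Y Z : topologicalType) (f : X -> Y) (g : X -> Z) :
  continuous f -> continuous g -> continuous (fun x => (f x, g x)).
Proof. by move=> cf cg x; apply: cvg_pair; [exact: cf|exact: cg]. Qed.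

Lemma continuous_comp2 (X Y Z W : topologicalType) (h : Y -> Z -> W)
    (f : X -> Y) (g : X -> Z) :
  continuous (fun p : Y * Z => h p.1 p.2) -> continuous f -> continuous g ->
  continuous (fun x => h (f x) (g x)).
Proof.
move=> ch cf cg x.
exact: (cvg_comp _ _ (continuous_pair cf cg (x := x)) (ch (f x, g x))).
Qed.

Lemma continuous_fst (X Y Z : topologicalType) (f : X -> Y) :
  continuous f -> continuous (fun p : X * Z => f p.1).
Proof. by move=> cf [x y]; apply: (cvg_comp fst f); [exact: cvg_fst|exact: cf]. Qed.

Lemma continuous_snd (X Y Z : topologicalType) (f : X -> Y) :
  continuous f -> continuous (fun p : Z * X => f p.2).
Proof. by move=> cf [x y]; apply: (cvg_comp snd f); [exact: cvg_snd|exact: cf]. Qed.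

Lemma continuous_cst (X Y : topologicalType) (y : Y) : continuous (fun _ : X => y).
Proof. by move=> x; exact: cvg_cst. Qed.

Lemma continuous_idfun (X : topologicalType) : continuous (fun x : X => x).
Proof. by move=> x; exact: cvg_id. Qed.

Lemma closed_equalizer (X Y : topologicalType) (f g : X -> Y) :
  hausdorff_space Y -> continuous f -> continuous g -> closed [set x | f x = g x].
Proof.
move=> hY cf cg.
rewrite (_ : [set x | _] = (fun x => (f x, g x)) @^-1` [set p | p.1 = p.2]) //.
apply: (iffLR (continuous_closedP _)); last exact: closed_diagonal.
exact: continuous_pair.
Qed.

(** The tube lemma. *)
Lemma open_forall (X Y : topologicalType) (P : set (X * Y)) :
  compact [set: X] -> open P -> open [set y | forall x, P (x, y)].
Proof.
move=> cX oP; rewrite openE => y Py.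
suff : \forall z \near y, [set: X] `<=` [set x | P (x, z)].
  by apply: filterS => z + x; apply.
apply: (iffLR (compact_near_coveringP _) cX) => x _.
move: oP; rewrite openE => /(_ _ (Py x))[[A B] [Ax By] AB].
by exists (A, B) => // -[u v] ?; exact: (AB (u, v)).
Qed.

Lemma closed_exists (X Y : topologicalType) (P : set (X * Y)) :
  compact [set: X] -> closed P -> closed [set y | exists x, P (x, y)].
Proof.
move=> cX cP; rewrite (_ : [set y | _] = ~` [set y | forall x, (~` P) (x, y)]).
  by apply: open_closedC; apply: open_forall => //; exact: closed_openC.
apply/seteqP; split=> y /=; first by move=> [x ?] /(_ x).
by move=> /existsNP[x /contrapT]; exists x.
Qed.

Lemma closed_forall (X Y : topologicalType) (P : X -> set Y) :
  (forall x, closed (P x)) -> closed [set y | forall x, P x y].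
Proof.
move=> cP; rewrite (_ : [set y | _] = \bigcap_(x in setT) P x); first exact: closed_bigI.
by apply/seteqP; split=> y /= Py; [move=> x _|move=> x; apply: Py].
Qed.

(** By compactness the largest saturated subset of an open set is open. Normality separates two
    distinct classes, which are closed, by open sets, and their saturated cores separate the points
    of the quotient. *)
Lemma closed_quotient (R : realType) (X : topologicalType) (E : X -> X -> Prop) :
  compact [set: X] -> hausdorff_space X -> closed [set p : X * X | E p.1 p.2] ->
  (forall x, E x x) -> (forall x y, E x y -> E y x) ->
  (forall x y w, E x y -> E y w -> E x w) ->
  exists (Q : topologicalType) (p : X -> Q) (r : Q -> X),
    [/\ cancel r p, forall x y, p x = p y <-> E x y, continuous p & hausdorff_space Q].
Proof.
move=> cX hX cE Er Es Et.
have [e1 e2 e3] : [/\ reflexive (fun x y => `[< E x y >]),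
    symmetric (fun x y => `[< E x y >]) & transitive (fun x y => `[< E x y >])].
  split.
  - by move=> x; apply/asboolP.
  - by move=> x y; apply: asbool_equiv_eq; split; exact: Es.
  - by move=> y x w /asboolW xy /asboolW yw; apply/asboolP; exact: Et xy yw.
pose e : equiv_rel X := EquivRel (fun x y => `[< E x y >]) e1 e2 e3.
pose Q := quotient_topology {eq_quot e}%qT.
pose p : X -> Q := \pi_Q%qT.
have pE x y : p x = p y <-> E x y.
  split => [/eqmodP/asboolW //|xy]; by apply/eqmodP/asboolP.
have rK : cancel (repr : Q -> X) p by exact: reprK.
exists Q, p, repr; split => //; first exact: pi_continuous.
have oE U : open U -> open [set y | forall x, E x y -> U x].
  move=> oU; apply: (@open_forall _ _ [set q | E q.1 q.2 -> U q.1]) => //.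
  rewrite (_ : [set q | _] = ~` ([set q | E q.1 q.2] `&` fst @^-1` (~` U))); last first.
    by apply/seteqP; split=> q /=; [tauto|move=> h Eq; apply: contrapT; tauto].
  apply: closed_openC; apply: closedI => //.
  apply: (iffLR (continuous_closedP _)); last exact: open_closedC.
  by move=> ?; exact: cvg_fst.
have Ey y : E (repr (p y)) y by apply/pE; rewrite rK.
have oQ U : open U -> open ([set q | forall x, E x (repr q) -> U x] : set Q).
  move=> /oE oU; rewrite /open /= /quotient_open.
  congr (open _): oU; apply/seteqP; split => y /= Uy x Ex; apply: Uy.
    exact: Et Ex (Ey y).
  exact: Et Ex (Es _ _ (Ey y)).
rewrite open_hausdorff => q q' /eqP qq'.
have nE : ~ E (repr q) (repr q').
  by move=> /pE; rewrite !rK.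
have cl1 x : closed [set y | E x y].
  have := iffLR (continuous_closedP (fun y => (x, y))) _ _ cE; apply.
  by apply: continuous_pair => y; [exact: cvg_cst|exact: cvg_id].
have nX : normal_space X by exact: compact_normal.
have [|U [V [oU oV qU q'V UV]]] :=
  iffLR (@normal_openP R X) nX _ _ (cl1 (repr q)) (cl1 (repr q')).
  by rewrite -subset0 => y /= [qy q'y]; apply: nE; apply: Et qy (Es _ _ q'y).
exists ([set q | forall x, E x (repr q) -> U x] : set Q,
  [set q | forall x, E x (repr q) -> V x] : set Q); split.
- by rewrite inE /= => x /Es /qU.
- by rewrite inE /= => x /Es /q'V.
- exact: oQ.
- exact: oQ.
- apply/eqP; rewrite -subset0 => w /= [Uw Vw].
  by have := UV; rewrite -subset0; apply; split; [apply: Uw|apply: Vw].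
Qed.

(** A continuous surjection from a compact space to a Hausdorff space is closed, hence a quotient
    map. *)
Lemma continuous_factor (X Y Z : topologicalType) (p : X -> Y) (f : Y -> Z) :
  compact [set: X] -> hausdorff_space Y -> continuous p ->
  (forall y, exists x, p x = y) -> continuous (f \o p) -> continuous f.
Proof.
move=> cX hY cp sp cfp; apply/continuous_closedP => C cC.
have -> : f @^-1` C = p @` ((f \o p) @^-1` C).
  apply/seteqP; split=> y /=; last by move=> [x ? <-].
  by have [x <-] := sp y; exists x.
apply: compact_closed => //; apply: continuous_compact.
  exact: continuous_subspaceT.
apply: subclosed_compact cX _ => //.
exact: (iffLR (continuous_closedP _) cfp).
Qed.

Record congruence (T : Type) (add mul : T -> T -> T) (E : T -> T -> Prop) : Prop :=
  Congruence {
    congruence_refl : forall x, E x x;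
    congruence_sym : forall x y, E x y -> E y x;
    congruence_trans : forall x y w, E x y -> E y w -> E x w;
    congruence_add : forall x y w, E x y -> E (add x w) (add y w);
    congruence_mull : forall x y w, E x y -> E (mul w x) (mul w y);
    congruence_mulr : forall x y w, E x y -> E (mul x w) (mul y w) }.

(** The projection to the quotient semiring is a continuous homomorphism to a Hausdorff semiring, so
    it is constant or injective. *)
Lemma simple_congruence (R : realType) (T : topologicalType)
    (add mul : T -> T -> T) (z : T) (E : T -> T -> Prop) :
    simple_top_semiring add mul z -> compact [set: T] ->
    closed [set p : T * T | E p.1 p.2] -> congruence add mul E ->
  (forall x y, E x y) \/ (forall x y, E x y -> x = y).
Proof.
move=> [[sT ca cm] [hT simpT]] cT cE EP.
have [addA [addC [add0 [mulA [mulD [Dmul mul0]]]]]] := sT.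
have [Er Es Et Ea Eml Emr] := EP.
have [Q [p [r [rK pE cp hQ]]]] := closed_quotient R cT hT cE Er Es Et.
have lift (f : T -> T -> T) : continuous (fun p => f p.1 p.2) ->
    (forall x y w, E x y -> E (f x w) (f y w)) ->
    (forall x y w, E x y -> E (f w x) (f w y)) ->
    (forall x y, p (f x y) = p (f (r (p x)) (r (p y)))) /\
    continuous (fun q => p (f (r q.1) (r q.2))).
  move=> cf fl fr.
  have fE x y : p (f x y) = p (f (r (p x)) (r (p y))).
    have rE t : E t (r (p t)) by apply/pE; rewrite rK.
    by apply/pE; apply: Et (fl _ _ _ (rE x)) (fr _ _ _ (rE y)).
  split=> //.
  (* The square of [p] is again a continuous surjection from a compact space to a Hausdorff one, so
     continuity can be tested before passing to the quotient. *)
  apply: (@continuous_factor _ _ _ (fun q : T * T => (p q.1, p q.2))).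
  - by rewrite -setXTT; exact: compact_setX.
  - exact: hausdorff_setX.
  - apply: continuous_pair => -[x y].
      by apply: (cvg_comp fst p); [exact: cvg_fst|exact: cp].
    by apply: (cvg_comp snd p); [exact: cvg_snd|exact: cp].
  - by move=> [q q']; exists (r q, r q'); rewrite /= !rK.
  - rewrite (_ : _ \o _ = fun q => p (f q.1 q.2)); last first.
      by apply: funext => q /=; rewrite -fE.
    by move=> q; exact: (cvg_comp _ _ (cf q) (cp _)).
have Ear x y w : E x y -> E (add w x) (add w y).
  by rewrite !(addC w); exact: Ea.
have [addE cadd] := lift _ ca Ea Ear.
have [mulE cmul] := lift _ cm Emr Eml.
pose addQ q q' := p (add (r q) (r q')).
pose mulQ q q' := p (mul (r q) (r q')).
have addQp x y : addQ (p x) (p y) = p (add x y) by rewrite /addQ -addE.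
have mulQp x y : mulQ (p x) (p y) = p (mul x y) by rewrite /mulQ -mulE.
have tQ : is_top_semiring addQ mulQ (p z).
  split => //; split; last split; last split; last split; last split; last split.
  - move=> q1 q2 q3; rewrite -(rK q1) -(rK q2) -(rK q3) !addQp.
    by rewrite addA.
  - by move=> q1 q2; rewrite /addQ addC.
  - by move=> q; rewrite -(rK q) addQp add0.
  - move=> q1 q2 q3; rewrite -(rK q1) -(rK q2) -(rK q3) !mulQp.
    by rewrite mulA.
  - move=> q1 q2 q3; rewrite -(rK q1) -(rK q2) -(rK q3).
    by rewrite !(mulQp, addQp) mulD.
  - move=> q1 q2 q3; rewrite -(rK q1) -(rK q2) -(rK q3).
    by rewrite !(mulQp, addQp) Dmul.
  - move=> q; rewrite -(rK q) !mulQp.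
    by have [-> ->] := mul0 (r q).
have hom : is_semiring_hom add mul z addQ mulQ (p z) p by split.
have [all_eq|nall] := pselect (forall x y, p x = p y).
  by left=> x y; apply/pE.
right=> x y /pE; apply: (simpT Q addQ mulQ (p z) tQ hQ p cp hom).
by move/existsNP: nall => [u /existsNP[v uv]]; exists u, v.
Qed.

(** * Simple compact semirings *)

Lemma compact_discrete_finite (X : topologicalType) :
  compact [set: X] -> (forall x : X, open [set x]) -> finite_set [set: X].
Proof.
move=> cX o1; have [s sP] : exists s : seq X, forall x, exists2 y, y \in s & [set y] x.
  by apply: compact_finite_selection => // x; exists x; exact: open_nbhs_nbhs.
apply: (@sub_finite_set _ _ [set` s]); last exact: finite_seq.
by move=> x _; have [y ys ->] := sP x.
Qed.

(** * Connectedness of infinite simple semirings *)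

Lemma clopen_equivalence (X Y : topologicalType) (A : set Y) (f g : X -> Y) :
  clopen A -> continuous f -> continuous g -> clopen [set x | A (f x) <-> A (g x)].
Proof.
move=> cA cf cg.
have -> : [set x | A (f x) <-> A (g x)] = (f @^-1` A `&` g @^-1` A) `|`
    (f @^-1` (~` A) `&` g @^-1` (~` A)).
  apply/seteqP; split => x /=; last tauto.
  by have [] := pselect (A (f x)); [left|right]; tauto.
apply: clopenU; apply: clopenI; (apply: preimage_clopen => //; exact: clopenC).
Qed.

Section Simple.
Variables (R : realType) (T : topologicalType) (add mul : T -> T -> T) (z : T).
Hypotheses (simpleT : simple_top_semiring add mul z) (cT : compact [set: T]).
Local Infix "+" := add.
Local Infix "*" := mul.

Let srT : is_semiring add mul z. Proof. by case: simpleT => [[]]. Qed.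
Let addA : associative add. Proof. by case: srT. Qed.
Let addC : commutative add. Proof. by case: srT => _ []. Qed.
Let add0 : left_id z add. Proof. by case: srT => _ [_ []]. Qed.
Let addr0 x : x + z = x. Proof. by rewrite addC add0. Qed.
Let mulA : associative mul. Proof. by case: srT => _ [_ [_ []]]. Qed.
Let mulDr x y w : x * (y + w) = x * y + x * w.
Proof. by case: srT => _ [_ [_ [_ []]]]. Qed.
Let mulDl x y w : (x + y) * w = x * w + y * w.
Proof. by case: srT => _ [_ [_ [_ [_ []]]]]. Qed.
Let mul0 x : z * x = z. Proof. by case: srT => _ [_ [_ [_ [_ [_ /(_ x)[]]]]]]. Qed.
Let mulr0 x : x * z = z. Proof. by case: srT => _ [_ [_ [_ [_ [_ /(_ x)[]]]]]]. Qed.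
Let hT : hausdorff_space T. Proof. by case: simpleT => _ []. Qed.
Let cadd : continuous (fun p : T * T => p.1 + p.2). Proof. by case: simpleT => [[]]. Qed.
Let cmul : continuous (fun p : T * T => p.1 * p.2). Proof. by case: simpleT => [[]]. Qed.
Let csimple := @simple_congruence R T add mul z.

Lemma continuous_add (X : topologicalType) (f g : X -> T) :
  continuous f -> continuous g -> continuous (fun x => f x + g x).
Proof. exact: continuous_comp2. Qed.

Lemma continuous_mul (X : topologicalType) (f g : X -> T) :
  continuous f -> continuous g -> continuous (fun x => f x * g x).
Proof. exact: continuous_comp2. Qed.

Ltac cont := repeat first
  [ assumption | exact: continuous_cst | exact: continuous_idfun | apply: continuous_add
  | apply: continuous_mul | exact: (continuous_fst (@continuous_idfun _))
  | exact: (continuous_snd (@continuous_idfun _))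
  | apply: continuous_fst | apply: continuous_snd].

(** The map [a * x * b + c], where the flags tell whether the factors [a] and [b] are present;
    omitting a factor stands in for a multiplicative identity. *)
Let translation (s t : bool) (a b c x : T) :=
  let y := if s then a * x else x in (if t then y * b else y) + c.

Lemma clopen_trivial (A : set T) x y : infinite_set [set: T] -> clopen A -> A x -> A y.
Proof.
move=> infT cA Ax.
pose E x y := forall s t (q : (T * T) * T), A (translation s t q.1.1 q.1.2 q.2 x) <->
   A (translation s t q.1.1 q.1.2 q.2 y).
have ctr (X : topologicalType) s t (f g h k : X -> T) :
    continuous f -> continuous g -> continuous h -> continuous k ->
    continuous (fun x => translation s t (f x) (g x) (h x) (k x)).
  by move=> cf cg ch ck; rewrite /translation; case: s; case: t => /=; cont.
have cE : closed [set p : T * T | E p.1 p.2].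
  apply: closed_forall => s; apply: closed_forall => t; apply: closed_forall => q.
  have [] // := @clopen_equivalence _ _ A
    (fun p : T * T => translation s t q.1.1 q.1.2 q.2 p.1)
    (fun p => translation s t q.1.1 q.1.2 q.2 p.2) cA; by apply: ctr; cont.
have EP : congruence add mul E.
  split.
  - by move=> ? ? ? ?.
  - by move=> u v uv s t q; apply: iff_sym.
  - by move=> u v w uv vw s t q; apply: iff_trans (uv s t q) (vw s t q).
  - move=> u v d uv s t [[a b] c] /=.
    have tE w : translation s t a b c (w + d) =
        translation s t a b (translation s t a b c d) w.
      by rewrite /translation; case: s; case: t; rewrite ?mulDr ?mulDl addA.
    by rewrite !tE; exact: (uv s t ((a, b), _)).
  - move=> u v w uv s t [[a b] c] /=.
    have tE k : translation s t a b c (w * k) =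
        translation true t (if s then a * w else w) b c k.
      by rewrite /translation; case: s; case: t; rewrite ?mulA.
    by rewrite !tE; exact: (uv true t ((_, b), c)).
  - move=> u v w uv s t [[a b] c] /=.
    have tE k : translation s t a b c (k * w) =
        translation s true a (if t then w * b else w) c k.
      by rewrite /translation; case: s; case: t; rewrite ?mulA.
    by rewrite !tE; exact: (uv s true ((a, _), c)).
have [tot|disc] := csimple simpleT cT cE EP.
  have /= := tot x y false false ((z, z), z).
  by rewrite /translation !addr0 => -[+ _]; apply.
case: infT; apply: compact_discrete_finite => // u.
have c11 : continuous (fun q : (T * T) * T => q.1.1).
  by apply: (@continuous_fst _ _ _ fst); cont.
have c12 : continuous (fun q : (T * T) * T => q.1.2).
  by apply: (@continuous_fst _ _ _ snd); cont.
(* The parameters range over a compact space, so quantifying over them keeps the clopen condition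
   open. The four flag pairs together describe the class of [u]. *)
have oE s t : open [set v | forall q, A (translation s t q.1.1 q.1.2 q.2 u) <->
   A (translation s t q.1.1 q.1.2 q.2 v)].
  apply: (@open_forall _ _ [set p | A (translation s t p.1.1.1 p.1.1.2 p.1.2 u) <->
   A (translation s t p.1.1.1 p.1.1.2 p.1.2 p.2)]).
    by rewrite -setXTT; apply: compact_setX => //; rewrite -setXTT; exact: compact_setX.
  have [] // := @clopen_equivalence _ _ A
    (fun p : (T * T * T) * T => translation s t p.1.1.1 p.1.1.2 p.1.2 u)
    (fun p => translation s t p.1.1.1 p.1.1.2 p.1.2 p.2) cA; by apply: ctr; cont;
    [exact: (continuous_fst c11)|exact: (continuous_fst c12)].
have := openI (openI (oE true true) (oE true false))
  (openI (oE false true) (oE false false)).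
congr (open _); apply/seteqP; split => v /=; last by move=> ->.
by move=> [[? ?] [? ?]]; apply/esym/disc => -[] [].
Qed.

(** * The additive monoid *)

Lemma additive_kernel : exists e, e + e = e /\ forall x, exists y, e = (e + x) + y.
Proof.
(* [k] is to lie in every ideal [x + T]. Otherwise the complements of finitely many such ideals
   cover [T], although the sum of their generators lies in all of them. *)
have [k kP] : exists k, forall x, exists y, k = x + y.
  apply: contrapT => /forallNP noK.
  have [|s sP] := compact_finite_selection
      (P := fun x => [set k | forall y, k <> x + y]) cT.
    move=> k; have /existsNP[x /forallNP kx] := noK k.
    exists x; apply: open_nbhs_nbhs; split => //.
    apply: (@open_forall _ _ [set p | p.2 <> x + p.1]) => //.
    by apply: closed_openC; apply: closed_equalizer => //; cont.
  have [x xs nx] := sP (foldr add z s).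
  suff [y /nx //] : exists y, foldr add z s = x + y.
  elim: s xs {sP nx} => //= w s IH; rewrite inE => /orP[/eqP ->|/IH[y ->]].
    by eexists.
  by exists (w + y); rewrite addA (addC w) -addA.
(* From [k = k + k + r] it follows that [k + r] is idempotent. *)
have [r kr] := kP (k + k).
exists (k + r); split=> [|x].
  by rewrite addA [k + r + k]addC addA -kr.
have [y ky] := kP ((k + r) + x); exists (y + r).
by rewrite addA -ky.
Qed.

(** [e] is the only idempotent of the form [e + u], and [e + w * e] is one. Hence
    [e + w * x = e + w * (e + x)], so the relation [e + x = e + y] respects multiplication. *)
Lemma additive_dichotomy :
  (forall x, exists y, x + y = z) \/ exists e, forall x, e + x = e.
Proof.
have [e [ee eP]] := additive_kernel.
have e_uniq u : (e + u) + (e + u) = e + u -> e + u = e.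
  move=> uu; have [y ey] := eP u.
  have <- : (e + u) + e = e + u by rewrite addC addA ee.
  by rewrite {2}ey addA uu -ey.
have eml w : e + w * e = e.
  by apply: e_uniq; rewrite addA [e + _ + _]addC addA ee -addA -mulDr ee.
have emr w : e + e * w = e.
  by apply: e_uniq; rewrite addA [e + _ + _]addC addA ee -addA -mulDl ee.
have [||tot|disc] := csimple (E := fun x y => e + x = e + y) simpleT cT.
- by apply: closed_equalizer => //; cont.
- split => //.
  + by move=> x y w -> ->.
  + by move=> x y w xy; rewrite !addA xy.
  + by move=> x y w xy; rewrite -(eml w) -!addA -!mulDr xy.
  + by move=> x y w xy; rewrite -(emr w) -!addA -!mulDl xy.
- by right; exists e => x; rewrite (tot x z) addr0.
- left=> x; have [y ey] := eP x.
  have ze : z = e by apply: disc; rewrite addr0 ee.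
  by exists y; rewrite [RHS]ze [in RHS]ey -ze add0.
Qed.

(** * The case of an absorbing element for addition *)

Section Absorbing.
Hypothesis infT : infinite_set [set: T].
Variable e : T.
Hypothesis eD : forall x, e + x = e.

Let De x : x + e = e. Proof. by rewrite addC eD. Qed.

Let zNe : z <> e.
Proof.
move=> ze; apply: infT; apply: (@sub_finite_set _ _ [set z]); last exact: finite_set1.
by move=> x _ /=; rewrite -(add0 x) ze eD.
Qed.

Lemma absorbing_trivial_mul : ~ (forall r x, r * x = z).
Proof.
move=> mulz.
have closedD x : closed [set u | exists a, u = x + a].
  apply: (@closed_exists _ _ [set p | p.2 = x + p.1]) => //.
  by apply: closed_equalizer => //; cont.
have inv x : x <> e -> exists y, z = x + y.
  move=> xNe.
  (* The Rees congruence collapsing [x + T]. It identifies [x] with [e = x + e], so it must be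
     total, which puts [z] in [x + T]. *)
  pose E u v := u = v \/ (exists a, u = x + a) /\ (exists a, v = x + a).
  have [||tot|disc] := csimple (E := E) simpleT cT.
  - apply: closedU; first exact: closed_diagonal.
    apply: closedI; apply: (iffLR (continuous_closedP _)) (closedD x); cont.
  - split; rewrite /E.
    + by move=> u; left.
    + by move=> u v [->|[]]; [left|right].
    + by move=> u v w [->//|[? ?]] [<-|[? ?]]; right.
    + move=> u v w [->|[[a ->] [b ->]]]; first by left.
      by right; split; [exists (a + w)|exists (b + w)]; rewrite addA.
    + by move=> u v w _; left; rewrite !mulz.
    + by move=> u v w _; left; rewrite !mulz.
  - by have [/zNe|[]] := tot z e.
  - case: xNe; apply: disc; right; split; first by exists z; rewrite addr0.
    by exists e; rewrite De.
have cl : clopen [set e].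
  split; last exact/accessible_closed_set1/hausdorff_accessible.
  rewrite (_ : [set e] = ~` [set x | exists y, z = x + y]).
    apply: closed_openC; apply: (@closed_exists _ _ [set p | z = p.2 + p.1]) => //.
    by apply: closed_equalizer => //; cont.
  apply/seteqP; split => [_ -> [y]|x nx]; first by rewrite eD.
  by apply: contrapT => /inv.
exact/zNe/(clopen_trivial z infT cl (erefl : [set e] e)).
Qed.

(** The hypotheses on products make [x + t = y + t] a congruence: the total relation gives [t = e],
    equality gives [t = z]. *)
Let bounded_trivial t : t + t = t -> (forall w, w * t + t = t) ->
  (forall w, t * w + t = t) -> t = z \/ t = e.
Proof.
move=> tt wt tw.
have [||tot|disc] := csimple (E := fun x y => x + t = y + t) simpleT cT.
- by apply: closed_equalizer => //; cont.
- split => //.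
  + by move=> x y w -> ->.
  + by move=> x y w xy; rewrite -!addA !(addC w) !addA xy.
  + by move=> x y w xy; rewrite -(wt w) !addA -!mulDr xy.
  + by move=> x y w xy; rewrite -(tw w) !addA -!mulDl xy.
- by right; have := tot z e; rewrite add0 eD.
- by left; apply: disc; rewrite add0 tt.
Qed.

Lemma absorbing_false : False.
Proof.
have [||tot|faith] := csimple (E := fun x y => forall r, r * x = r * y) simpleT cT.
- by apply: closed_forall => r; apply: closed_equalizer => //; cont.
- split => //.
  + by move=> x y w xy yw r; rewrite xy.
  + by move=> x y w xy r; rewrite !mulDr xy.
  + by move=> x y w xy r; rewrite !mulA xy.
  + by move=> x y w xy r; rewrite !mulA xy.
- by apply: absorbing_trivial_mul => r x; rewrite (tot x z) mulr0.
have ee : e * e = e.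
  have [||| ee0 |//] := @bounded_trivial (e * e).
  - by rewrite -mulDl eD.
  - by move=> w; rewrite mulA -mulDl De.
  - by move=> w; rewrite -mulA -mulDr De.
  (* If [e * e = z], expanding [(r + e) * e] yields [r * e = z] for every [r], and faithfulness
     gives [z = e]. *)
  case: zNe; apply: faith => r; rewrite mulr0.
  by have := mulDl r e e; rewrite De ee0 addr0.
have eae a : e * a * e = z \/ e * a * e = e.
  apply: bounded_trivial.
  - by rewrite -mulDr eD.
  - by move=> w; rewrite !mulA -!mulDl De.
  - by move=> w; rewrite -(mulA _ e w) -mulDr De.
have c1 w : closed [set a | e * a * e = w] by apply: closed_equalizer => //; cont.
(* Two closed sets partition [T]; this one contains [e] but not [z]. *)
have cl : clopen [set a | e * a * e = e].
  split=> //; rewrite (_ : mkset _ = ~` [set a | e * a * e = z]).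
    exact: closed_openC.
  apply/seteqP; split=> a /=; first by move=> ->; exact/nesym.
  by move=> /= ?; case: (eae a).
have : [set a | e * a * e = e] z.
  by apply: (@clopen_trivial _ e) => //=; rewrite ee.
by rewrite /= mulr0 mul0 => /zNe.
Qed.

End Absorbing.

(** * The ring case *)

Section Ring.
Hypothesis infT : infinite_set [set: T].
Hypothesis inv : forall x, exists y, x + y = z.

Lemma ring_character : exists a b : T -> R, [/\ continuous a, continuous b,
    forall x y, a (x + y) = (a x * a y - b x * b y)%R /\
                b (x + y) = (a x * b y + b x * a y)%R,
    forall x, (a x ^+ 2 + b x ^+ 2 = 1)%R & exists x, a x != 1%R].
Proof.
have /choice[opp oppP] := inv.
(* The graph of [opp] is closed, and projection along the compact [T] preserves closed sets. *)
have copp : continuous opp.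
  apply/continuous_closedP => C cC.
  rewrite (_ : opp @^-1` C = [set x | exists y,
      ([set p | z = p.2 + p.1] `&` fst @^-1` C) (y, x)]).
    apply: closed_exists => //; apply: closedI.
      by apply: closed_equalizer => //; cont.
    by apply: (iffLR (continuous_closedP _)) cC; cont.
  apply/seteqP; split=> x /=; first by exists (opp x); rewrite oppP.
  move=> [y [zy Cy]]; suff -> : opp x = y by [].
  by rewrite -[opp x]addr0 zy addA (addC (opp x)) oppP add0.
have addN : left_inverse z opp add by move=> x; rewrite addC oppP.
pose G0 : PreTopologicalZmodule.type :=
  HB.pack T (GRing.isZmodule.Build T addA addC add0 addN).
pose addG := @PreTopologicalNmodule_isTopologicalNmodule.Build G0 cadd.
pose oppG := @TopologicalNmodule_isTopologicalZmodule.Build G0 copp.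
pose G : topologicalZmodType := HB.pack (PreTopologicalZmodule.sort G0) addG oppG.
have [g0 g0z] : exists g0, g0 <> z.
  apply: contrapT => /forallNP allz; apply: infT.
  apply: (@sub_finite_set _ _ [set z]); last exact: finite_set1.
  by move=> x _; apply: contrapT; exact: allz.
have [|a [b [ca cb abD ab1 ag0]]] := @circle_character R G cT hT g0; first exact/eqP.
by exists a, b; split => //; exists g0.
Qed.

Lemma ring_false : False.
Proof.
have [a [b [ca cb abD ab1 [g0 ag0]]]] := ring_character.
have [az bz] : a z = 1%R /\ b z = 0%R.
  have := ab1 z; have := abD z z; rewrite add0 => -[ha hb] h1.
  have bz : b z = 0%R.
    have /eqP : (b z * (2 * a z - 1) = 0)%R by lra.
    rewrite mulf_eq0 => /orP[/eqP //|/eqP h]; nra.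
  by split => //; move: ha h1; rewrite bz; nra.
have a_dbl x : a (x + x) = (2 * a x ^+ 2 - 1)%R.
  by have [-> _] := abD x x; have := ab1 x; lra.
pose dbl k x := iter k (fun y => y + y) x.
(* As [1 - a (y + y) = 2 * (1 - a y) * (1 + a y)], the quantity [1 - a] at least doubles while [a]
   is positive, yet it stays below 1; so it is 0. *)
have a1_dbl x : (forall k, 0 < a (dbl k x))%R -> a x = 1%R.
  move=> apos.
  have a_le1 y : (a y <= 1)%R by have := ab1 y; nra.
  have grow k : (2 ^+ k * (1 - a x) <= 1 - a (dbl k x))%R.
    elim: k => [|k IH]; first by rewrite expr0 mul1r.
    rewrite exprS -mulrA; apply: (@le_trans _ _ (2 * (1 - a (dbl k x)))%R).
      by rewrite ler_pM2l.
    by rewrite [dbl _.+1 x]iterS a_dbl; have := apos k; have := a_le1 (dbl k x); nra.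
  apply/eqP; rewrite eq_le a_le1 /= leNgt; apply/negP => lt1.
  have d0 : (0 < 1 - a x)%R by lra.
  have [k ltk] : exists k, ((1 - a x)^-1 < 2 ^+ k)%R.
    exists (Num.bound (1 - a x)^-1)%R.
    apply: lt_trans (archi_boundP _) _; first by rewrite invr_ge0 ltW.
    by rewrite -natrX ltr_nat ltn_expl.
  have := grow k; have := apos k.
  have : (1 < 2 ^+ k * (1 - a x))%R by rewrite -ltr_pdivrMr // mul1r.
  lra.
have b0 x : a x = 1%R -> b x = 0%R.
  by move=> ax; have := ab1 x; rewrite ax => h; apply/eqP;
    rewrite -sqrf_eq0; apply/eqP; lra.
have dbl_mul k r v : dbl k (r * v) = dbl k r * v.
  by elim: k => //= k ->; rewrite mulDl.
have open_pos (X : topologicalType) (f : X -> T) :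
    continuous f -> open [set x | 0 < a (f x)]%R.
  move=> cf; apply: (@open_comp _ _ (a \o f) [set t | 0 < t]%R); last exact: open_gt.
  by move=> x _; apply: (cvg_comp _ _ (cf x)); exact: ca.
(* The set [I] is open through [0 < a] and closed through [a = 1]. The two descriptions agree
   because doubling [r * v] amounts to doubling [r]. *)
have mul1 r v : a (r * v) = 1%R.
  pose I := [set v | forall r, 0 < a (mul r v)]%R.
  have IE : I = [set v | forall r, a (r * v) = 1%R].
    apply/seteqP; split=> w /= Iw s; last by rewrite Iw.
    by apply: a1_dbl => k; rewrite dbl_mul; exact: Iw.
  have clI : clopen I.
    split.
      apply: (@open_forall _ _ [set p | 0 < a (mul p.1 p.2)]%R) => //.
      exact: open_pos.
    rewrite IE; apply: closed_forall => s.
    apply: closed_equalizer; [exact: Rhausdorff| |exact: continuous_cst].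
    move=> w; apply: (cvg_comp (fun v => s * v) a); last exact: ca.
    by apply: continuous_mul; cont.
  have : I v by apply: (@clopen_trivial I z) => //= s; rewrite mulr0 az.
  by rewrite IE => /(_ r).
(* The target is the whole plane: complex multiplication acts as addition with zero [(1, 0)], and
   every product is [(1, 0)]. *)
pose addS (p q : R * R) := ((p.1 * q.1 - p.2 * q.2)%R, (p.1 * q.2 + p.2 * q.1)%R).
pose mulS (p q : R * R) : R * R := (1%R, 0%R).
have tS : @is_top_semiring (R * R)%type addS mulS (1%R, 0%R).
  split; last by move=> p; exact: cvg_cst.
    split; last split; last split; last split; last split; last split.
    - by move=> [? ?] [? ?] [? ?]; rewrite /addS; congr pair => /=; ring.
    - by move=> [? ?] [? ?]; rewrite /addS; congr pair => /=; ring.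
    - by move=> [? ?]; rewrite /addS; congr pair => /=; ring.
    - by [].
    - by move=> ? ? ?; rewrite /addS /mulS; congr pair => /=; ring.
    - by move=> ? ? ?; rewrite /addS /mulS; congr pair => /=; ring.
    - by [].
  have c11 : continuous (fun p : (R * R) * (R * R) => p.1.1).
    by apply: (@continuous_fst _ _ _ fst); cont.
  have c12 : continuous (fun p : (R * R) * (R * R) => p.1.2).
    by apply: (@continuous_fst _ _ _ snd); cont.
  have c21 : continuous (fun p : (R * R) * (R * R) => p.2.1).
    by apply: (@continuous_snd _ _ _ fst); cont.
  have c22 : continuous (fun p : (R * R) * (R * R) => p.2.2).
    by apply: (@continuous_snd _ _ _ snd); cont.
  apply: continuous_pair => p; first apply: cvgB; last apply: cvgD;
    by apply: cvgM; [exact: c11 || exact: c12|exact: c21 || exact: c22].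
have hS : hausdorff_space (R * R)%type by apply: hausdorff_setX; exact: Rhausdorff.
have [_ [_ simpT]] := simpleT.
have ab_inj : injective (fun x => (a x, b x)).
  apply: (simpT (R * R)%type addS mulS (1%R, 0%R)) => //.
  - exact: continuous_pair.
  - split=> [|x y|x y]; first by rewrite az bz.
      by have [-> ->] := abD x y.
    by rewrite mul1 b0.
  - by exists g0, z => -[]; rewrite az => /eqP; rewrite (negPf ag0).
have mulz r v : r * v = z by apply: ab_inj; rewrite mul1 b0 // az bz.
(* If [a] never vanishes, positivity of [a] is a clopen condition true at [z], hence true
   everywhere, and [a1_dbl] gives [a g0 = 1]. *)
have [y ay] : exists y, a y = 0%R.
  apply: contrapT => /forallNP noy.
  have clP : clopen [set x | 0 < a x]%R.
    split; first by apply: open_pos; exact: continuous_idfun.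
    have -> : [set x | 0 < a x]%R = a @^-1` [set t | 0 <= t]%R.
      apply/seteqP; split=> x /=; first exact: ltW.
      by rewrite le_eqVlt => /orP[/eqP/esym/noy|].
    by apply: (iffLR (continuous_closedP _) ca); exact: closed_ge.
  suff ag1 : a g0 = 1%R by rewrite ag1 eqxx in ag0.
  apply: a1_dbl => k; apply: (@clopen_trivial [set x | 0 < a x]%R z) => //=.
  by rewrite az.
(* [y2] is sent to -1, so it is a nonzero element killed by doubling. As all products vanish,
   doubling is a continuous endomorphism; it is not constant, for [y + y] differs from [z + z], and
   simplicity would make it injective. *)
pose y2 := y + y.
have ay2 : a y2 = (-1)%R by rewrite a_dbl ay; lra.
have y2z : y2 <> z by move=> /(congr1 a); rewrite ay2 az; lra.
have y4z : y2 + y2 = z.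
  have a1 : a (y2 + y2) = 1%R by rewrite a_dbl ay2; lra.
  by apply: ab_inj; rewrite a1 b0 // az bz.
have [|dbl_cst] := pselect (exists x x', x + x <> x' + x').
  move=> /(simpT T add mul z (proj1 simpleT) hT (fun x => x + x) _ _) dbl_inj.
  apply/y2z/dbl_inj => [||]; last by rewrite y4z add0.
  - by apply: continuous_add; cont.
  - split; first by rewrite add0.
      by move=> x x'; rewrite -!addA; congr (x + _); rewrite addC -addA.
    by move=> x x'; rewrite !mulz add0.
apply: y2z; apply: contrapT => h; apply: dbl_cst; exists y, z.
by rewrite add0.
Qed.

End Ring.

End Simple.

Theorem theorem4p6 (T : topologicalType) (add mul : T -> T -> T) (z : T) :
  simple_top_semiring add mul z ->
  compact [set: T] ->
  finite_set [set: T].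
Proof.
move=> sT cT; apply: contrapT => infT.
have [inv|[e eD]] := additive_dichotomy Rdefinitions.R sT cT.
  exact: (ring_false Rdefinitions.R sT cT infT inv).
exact: (absorbing_false Rdefinitions.R sT cT infT eD).
Qed.
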